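(* Let $n$ be a positive integer with $n\neq 4$, and let $U$ be a linear subspace of $\mathfrak{sl}_n(\mathbf{C})$ of dimension $d$ with $(n-1)^2<d<n^2-1$. Let $\mathrm{SL}_n(\mathbf{C})$ act on $\mathfrak{sl}_n(\mathbf{C})$ by conjugation. Then \[ \mathrm{diam}_+^{\mathrm{SL}_n(\mathbf{C})}(\mathfrak{sl}_n(\mathbf{C}),U)=2 . \]
   Context: For a group $G$, a finite-dimensional complex representation $\rho\colon G\to\mathrm{GL}(V)$ and a linear subspace $U\leq V$, the $G$-additive diameter of $V$ with respect to $U$ is \[ \mathrm{diam}_+^G(V,U)=\min\{d \mid \rho(g_1)\cdot U+\dots+\rho(g_d)\cdot U=V \text{ for some } g_1,\dots,g_d\in G\}, \] with value $\infty$ if no such $d$ exists. $\mathfrak{sl}_n(\mathbf{C})$ is the space of traceless complex $n\times n$ matrices. *)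

(* Defs.v *)
From HB Require Import structures.
From mathcomp Require Import all_boot all_order all_algebra.
From mathcomp Require Import boolp reals complex.

Set Implicit Arguments.
Unset Strict Implicit.
Unset Printing Implicit Defensive.

Import GRing.Theory.
Local Open Scope ring_scope.

Record representation (G : groupType) (F : fieldType) (V : vectType F) :=
  Representation {
    rep_fun :> G -> 'End(V);
    rep1 : rep_fun 1%g = \1%VF;
    repM : forall g h : G, rep_fun (g * h)%g = (rep_fun g \o rep_fun h)%VF
  }.

Section AdditiveDiameter.
Variables (G : groupType) (F : fieldType) (V : vectType F).
Variables (rho : representation G V) (U : {vspace V}).

Definition translates_span (d : nat) : Prop :=
  exists g : 'I_d -> G, (\sum_(i < d) (rho (g i) @: U))%VS = fullv.

Lemma asbool_translates_span :
  (exists d, translates_span d) -> exists d, `[< translates_span d >].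
Proof. by case=> d Ud; exists d; apply/asboolP. Qed.

(* Values in the natural numbers extended by infinity, encoded as [None]. *)
Definition additive_diam : option nat :=
  if pselect (exists d, translates_span d) is left exU
  then Some (ex_minn (asbool_translates_span exU))
  else None.

End AdditiveDiameter.

Section SpecialLinear.
Variables (F : fieldType) (n : nat).

Definition SL : predArgType := {A : 'M[F]_n | \det A == 1}.

Implicit Types g h : SL.

Lemma SL_det g : \det (val g) = 1.
Proof. exact/eqP/(valP g). Qed.

Lemma SL_unitmx g : val g \in unitmx.
Proof. by rewrite unitmxE SL_det unitr1. Qed.

Fact SL_one_subproof : \det (1%:M : 'M[F]_n) == 1.
Proof. by rewrite det1. Qed.

Fact SL_mul_subproof g h : \det (val g *m val h) == 1.
Proof. by rewrite det_mulmx !SL_det mulr1. Qed.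

Fact SL_inv_subproof g : \det (invmx (val g)) == 1.
Proof. by rewrite det_inv SL_det invr1. Qed.

Definition SL_one : SL := Sub (1%:M : 'M[F]_n) SL_one_subproof.
Definition SL_mul g h : SL := Sub (val g *m val h) (SL_mul_subproof g h).
Definition SL_inv g : SL := Sub (invmx (val g)) (SL_inv_subproof g).

Fact SL_mulA : associative SL_mul.
Proof. by move=> g h k; apply: val_inj; rewrite /= mulmxA. Qed.

Fact SL_mul1g : left_id SL_one SL_mul.
Proof. by move=> g; apply: val_inj; rewrite /= mul1mx. Qed.

Fact SL_mulg1 : right_id SL_one SL_mul.
Proof. by move=> g; apply: val_inj; rewrite /= mulmx1. Qed.

Fact SL_mulVg : left_inverse SL_one SL_inv SL_mul.
Proof. by move=> g; apply: val_inj; rewrite /= mulVmx ?SL_unitmx. Qed.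

Fact SL_mulgV : right_inverse SL_one SL_inv SL_mul.
Proof. by move=> g; apply: val_inj; rewrite /= mulmxV ?SL_unitmx. Qed.

HB.instance Definition _ := Choice.on SL.
HB.instance Definition _ :=
  isGroup.Build SL SL_mulA SL_mul1g SL_mulg1 SL_mulVg SL_mulgV.

Definition sl_vspace : {vspace 'M[F]_n} :=
  lker (linfun (fun A : 'M[F]_n => \tr A : F^o)).

Lemma mem_sl_vspace (A : 'M[F]_n) : (A \in sl_vspace) = (\tr A == 0).
Proof. by rewrite memv_ker lfunE. Qed.

Definition sl : vectType F := subvs_of sl_vspace.

Fact sl_conj_subproof g (X : sl) :
  val g *m vsval X *m invmx (val g) \in sl_vspace.
Proof.
rewrite mem_sl_vspace mxtrace_mulC mulmxA mulVmx ?SL_unitmx // mul1mx.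
by rewrite -mem_sl_vspace subvsP.
Qed.

Definition sl_conj g (X : sl) : sl := Subvs (sl_conj_subproof g X).

Fact sl_conj_is_linear g : linear (sl_conj g).
Proof.
move=> a X Y; apply: val_inj => /=.
by rewrite mulmxDr mulmxDl -scalemxAr -scalemxAl.
Qed.

HB.instance Definition _ g :=
  GRing.isLinear.Build F sl sl *:%R (sl_conj g) (sl_conj_is_linear g).

Fact sl_conj1 : linfun (sl_conj 1%g) = \1%VF.
Proof.
apply/lfunP=> X; rewrite !lfunE; apply: val_inj => /=.
by rewrite invmx1 mulmx1 mul1mx.
Qed.

Fact sl_conjM g h :
  linfun (sl_conj (g * h)%g) = (linfun (sl_conj g) \o linfun (sl_conj h))%VF.
Proof.
apply/lfunP=> X; rewrite comp_lfunE !lfunE; apply: val_inj => /=.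
have -> : invmx (val g *m val h) = invmx (val h) *m invmx (val g).
  exact: (congr1 (fun k : SL => val k) (invgM g h)).
by rewrite !mulmxA.
Qed.

Definition sl_conj_rep : representation SL sl :=
  Representation sl_conj1 sl_conjM.

End SpecialLinear.

(* Main.v *)
Require Import Defs.
From HB Require Import structures.
From mathcomp Require Import all_boot all_order all_algebra.
From mathcomp Require Import fingroup perm zify ring boolp.
From mathcomp Require Import reals complex.

(** By trace duality the claim is that a traceless subspace [W] with
    [dim W + 2 < 2 * n] meets some conjugate [h * W * h^-1] trivially.  Degenerate
    [W] under a one-parameter subgroup of the torus whose weights separate the
    matrix units; meeting a conjugate trivially is an open condition, so it passes
    from the limit [initial W] back to [W].  Alternating such limits with
    conjugations by [1 + E_ij], [i < j], strictly decreases a dimension count until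
    the subspace is graded and stable under [ad E_ij].  For such a subspace [X] the
    longest Weyl group element works: a common vector of [X] and its reversal is
    either not diagonal, and then [X] contains a negative root vector [E_ij],
    hence its coroot and all positive root vectors meeting [{i, j}], or diagonal
    and not scalar, and then [X] contains two rectangles of positive root vectors;
    both are too many, except for two equal rectangles when [n = 4]. *)

Set Implicit Arguments.
Unset Strict Implicit.
Unset Printing Implicit Defensive.

Import Order.TTheory GRing.Theory Num.Theory.
Import passmx.
Local Open Scope ring_scope.

(** * Invertibility in polynomial families of endomorphisms *)

Section PolynomialFamilies.
Variables (F : numFieldType) (V : vectType F).

(** In characteristic zero the naturals below [size q] are too many distinct points to be all roots
    of [q]; the factor ['X] rules out [s = 0]. *)
Lemma poly_neq0_nonroot (p : {poly F}) :
  p != 0 -> exists2 s : F, s != 0 & p.[s] != 0.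
Proof.
move=> p0; pose q := 'X * p.
have q0 : q != 0 by rewrite mulf_neq0 // polyX_eq0.
pose rs := [seq (i : nat)%:R : F | i <- iota 0 (size q)].
have urs : uniq rs.
  by rewrite map_inj_uniq ?iota_uniq // => i j /eqP; rewrite eqr_nat => /eqP.
have /allPn[s _ qs] : ~~ all (root q) rs.
  apply/negP => all_rs; have := max_poly_roots q0 all_rs urs.
  by rewrite size_map size_iota ltnn.
by move: qs; rewrite /root hornerM hornerX mulf_eq0 negb_or => /andP[]; exists s.
Qed.

(** The determinant of the family is a polynomial in [s] with value 1 at [s = 0]. Openness of a
    generic condition is used in this form. *)
Lemma lker0_family (N : nat) (h : nat -> 'End(V)) : h 0 = \1%VF ->
  exists2 s : F, s != 0 & lker (\sum_(i < N.+1) s ^+ i *: h i) == 0%VS.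
Proof.
move=> h0.
pose e := vbasis (fullv : {vspace V}).
have free_e : free e := basis_free (vbasisP _).
pose M i := mxof e e (h i).
pose P := \sum_(i < N.+1) 'X^i *: map_mx polyC (M i).
have detP s : (\det P).[s] = \det (\sum_(i < N.+1) s ^+ i *: M i).
  rewrite -horner_evalE -det_map_mx; congr (\det _).
  apply/matrixP => i j; rewrite [LHS]mxE /horner_eval /P !summxE rmorph_sum /=.
  by apply: eq_bigr => k _; rewrite !mxE /horner_eval hornerM hornerXn hornerC.
have sumE s : \sum_(i < N.+1) s ^+ i *: M i = mxof e e (\sum_(i < N.+1) s ^+ i *: h i).
  by rewrite linear_sum /=; apply: eq_bigr => i _; rewrite linearZ.
have /poly_neq0_nonroot[s s0] : \det P != 0.
  apply/eqP => P0; have := detP 0; rewrite P0 horner0 sumE.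
  rewrite big_ord_recl big1 => [|i _]; last by rewrite expr0n scale0r.
  by rewrite expr0 scale1r addr0 h0 mxof1 // det1 => /esym /eqP; rewrite oner_eq0.
rewrite detP sumE => Ds; exists s => //.
apply/lker0P => u v /(congr1 (rVof e)).
rewrite !(rVof_app e (vbasisP _)) => /(congr1 (fun w => w *m invmx (mxof e e (\sum_(i < N.+1) s ^+ i *: h i)))).
rewrite -!mulmxA mulmxV ?unitmxE ?unitfE // !mulmx1.
by move=> /(can_inj (rVofK (vbasisP _))).
Qed.

End PolynomialFamilies.

(** * Gradings, filtrations and initial subspaces *)

Record grading (F : fieldType) (V : vectType F) (N : nat) := Grading {
  component :> nat -> 'End(V);
  component_comp : forall k l v,
    component k (component l v) = if k == l then component k v else 0;
  component_sum : forall v, \sum_(k < N) component k v = v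
}.

Section Gradings.
Variables (F : fieldType) (V : vectType F) (N : nat) (pr : grading V N).
Implicit Types (U W : {vspace V}) (u v w : V) (k l m : nat).

Lemma componentK k v : pr k (pr k v) = pr k v.
Proof. by rewrite component_comp eqxx. Qed.

Lemma component_large k v : (N <= k)%N -> pr k v = 0.
Proof.
move=> Nk; rewrite -(component_sum pr v) linear_sum /= big1 // => l _.
by rewrite component_comp gtn_eqF // (leq_trans (ltn_ord l)).
Qed.

Lemma component_ext u v : (forall k, pr k u = pr k v) -> u = v.
Proof.
by move=> uv; rewrite -(component_sum pr u) -(component_sum pr v); apply: eq_bigr.
Qed.

Definition filt m : {vspace V} := (\bigcap_(k < N | (m <= k)%N) lker (pr k))%VS.
Definition cofilt m : {vspace V} := (\bigcap_(k < N | (k < m)%N) lker (pr k))%VS.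

Lemma filtP m v : reflect (forall k, (m <= k)%N -> pr k v = 0) (v \in filt m).
Proof.
rewrite memvE; apply: (iffP subv_bigcapP) => [vm k mk | vm k mk].
  have [Nk|kN] := leqP N k; first exact: component_large.
  by apply/eqP; rewrite -memv_ker memvE; apply: (vm (Ordinal kN)).
by rewrite -memvE memv_ker vm.
Qed.

Lemma cofiltP m v : reflect (forall k, (k < m)%N -> pr k v = 0) (v \in cofilt m).
Proof.
rewrite memvE; apply: (iffP subv_bigcapP) => [vm k mk | vm k mk].
  have [Nk|kN] := leqP N k; first exact: component_large.
  by apply/eqP; rewrite -memv_ker memvE; apply: (vm (Ordinal kN)).
by rewrite -memvE memv_ker vm.
Qed.

Lemma component_filt k v : pr k v \in filt k.+1.
Proof. by apply/filtP => l kl; rewrite component_comp gtn_eqF. Qed.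

(** Leading forms of degree [k], as for initial ideals; [initial W] is the limit of [W] under
    rescalings that let the top degree dominate. *)
Definition lead W k : {vspace V} := (pr k @: (W :&: filt k.+1))%VS.
Definition initial W : {vspace V} := (\sum_(k < N) lead W k)%VS.
Definition graded W := forall k v, v \in W -> pr k v \in W.
(** Grows as [W] sinks to lower degrees; this is the measure that drops along the descent. *)
Definition weight W := (\sum_(m < N.+1) \dim (W :&: filt m))%N.

Lemma lead_initial W k : (lead W k <= initial W)%VS.
Proof.
have [Nk|kN] := leqP N k; last exact: (sumv_sup (Ordinal kN)).
apply/subvP => _ /memv_imgP[v _ ->].
by rewrite component_large ?mem0v.
Qed.

Lemma component_initial W k v : v \in initial W -> pr k v \in lead W k.
Proof.
case/memv_sumP => w lead_w ->; rewrite linear_sum /=.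
apply: memv_suml => l _; case/memv_imgP: (lead_w l isT) => x xW ->.
rewrite component_comp; case: eqP => [kl | _]; last exact: mem0v.
by rewrite kl memv_img.
Qed.

Lemma initial_graded W : graded (initial W).
Proof.
by move=> k v vX; apply: (subvP (lead_initial W k)); apply: component_initial.
Qed.

(** Rank-nullity for [pr m] on [W :&: filt m.+1], where its kernel is [W :&: filt m]. *)
Lemma dim_filt W m : \dim (W :&: filt m) = (\sum_(k < m) \dim (lead W k))%N.
Proof.
elim: m => [|m IHm].
  rewrite big_ord0; apply/eqP; rewrite dimv_eq0 -subv0; apply/subvP => v.
  case/memv_capP => _ /filtP v0; rewrite memv0; apply/eqP/component_ext => k.
  by rewrite v0 // linear0.
rewrite big_ord_recr /= -IHm -(limg_ker_dim (pr m)); congr (\dim _ + _)%N.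
apply/vspaceP => v; rewrite !memv_cap memv_ker -andbA; congr (_ && _).
apply/andP/idP => [[/filtP vm /eqP vm0] | /filtP vm].
  by apply/filtP => k; rewrite leq_eqVlt => /predU1P[<-|/vm].
by split; [apply/filtP => k /ltnW | apply/eqP]; apply: vm.
Qed.

Lemma filt_full : filt N = fullv.
Proof.
by apply/vspaceP => v; rewrite memvf; apply/filtP => k; apply: component_large.
Qed.

(** By [dim_filt] it suffices that [initial W] and [W] have the same leading forms in every
    degree. *)
Lemma dim_initial_filt W m : \dim (initial W :&: filt m) = \dim (W :&: filt m).
Proof.
rewrite !dim_filt; apply: eq_bigr => k _; congr (\dim _).
apply/eqP; rewrite eqEsubv; apply/andP; split.
  by apply/subvP => _ /memv_imgP[v /memv_capP[vX _] ->]; apply: component_initial.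
apply/subvP => _ /memv_imgP[v vW ->]; rewrite -componentK; apply: memv_img.
rewrite memv_cap component_filt andbT.
by apply: (subvP (lead_initial W k)); apply: memv_img.
Qed.

Lemma dim_initial W : \dim (initial W) = \dim W.
Proof. by have := dim_initial_filt W N; rewrite filt_full !capvf. Qed.

Lemma weight_initial W : weight (initial W) = weight W.
Proof. by apply: eq_bigr => m _; apply: dim_initial_filt. Qed.

Lemma filt_cofilt m : (filt m :&: cofilt m)%VS = 0%VS.
Proof.
apply/eqP; rewrite -subv0; apply/subvP => v /memv_capP[/filtP v1 /cofiltP v2].
rewrite memv0; apply/eqP/component_ext => k; rewrite linear0.
by case: (leqP m k) => [/v1 | /v2].
Qed.

Lemma graded_split W m : graded W ->
  (\dim (W :&: filt m) + \dim (W :&: cofilt m))%N = \dim W.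
Proof.
move=> gW; rewrite -dimv_disjoint_sum; last first.
  apply/eqP; rewrite -subv0 -(filt_cofilt m).
  by apply: capvS; apply: capvSr.
congr (\dim _); apply/eqP; rewrite eqEsubv subv_add !capvSl /=.
apply/subvP => v vW; rewrite -(component_sum pr v).
rewrite (bigID (fun k : 'I_N => k < m)%N) /=.
apply: memv_add; rewrite memv_cap; apply/andP; split.
- by apply: memv_suml => k _; apply: gW.
- apply: memv_suml => k km; apply/filtP => l ml.
  by rewrite component_comp gtn_eqF // (leq_trans km).
- by apply: memv_suml => k _; apply: gW.
- apply: memv_suml => k; rewrite -leqNgt => km; apply/cofiltP => l ml.
  by rewrite component_comp ltn_eqF // (leq_trans ml).
Qed.

(** * Operators [1 + x + y] where [x] raises degrees by [a] and [y] by [2 * a] *)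

Section Raising.
Variables (a : nat) (u x y : 'End(V)).
Hypothesis a_gt0 : (0 < a)%N.
Hypothesis uE : forall v, u v = v + x v + y v.
Hypothesis x_component : forall k v, x (pr k v) = pr (k + a)%N (x v).
Hypothesis y_component : forall k v, y (pr k v) = pr (k + (a + a))%N (y v).
Hypothesis ker_u : lker u == 0%VS.

Lemma shift_below b (z : 'End(V)) :
    (forall k v, z (pr k v) = pr (k + b)%N (z v)) ->
  forall k v, (k < b)%N -> pr k (z v) = 0.
Proof.
move=> zE k v kb; rewrite -(component_sum pr v) !linear_sum /= big1 // => l _.
by rewrite zE component_comp ltn_eqF // (leq_trans kb) // leq_addl.
Qed.

Lemma shift_cofilt b (z : 'End(V)) :
    (forall k v, z (pr k v) = pr (k + b)%N (z v)) ->
  forall m v, v \in cofilt m -> z v \in cofilt m.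
Proof.
move=> zE m v /cofiltP vm; apply/cofiltP => k km.
have [bk|kb] := leqP b k; last exact: (shift_below zE).
rewrite -(subnK bk) -zE vm ?linear0 //.
by apply: leq_ltn_trans km; apply: leq_subr.
Qed.

Lemma raising_cofilt m v : v \in cofilt m -> u v \in cofilt m.
Proof.
move=> vm; rewrite uE; apply: memvD; first apply: memvD => //.
- exact: (shift_cofilt x_component).
- exact: (shift_cofilt y_component).
Qed.

Lemma raising_disjoint W m :
  ((u @: W :&: filt m) :&: (u @: (W :&: cofilt m)))%VS = 0%VS.
Proof.
apply/eqP; rewrite -subv0 -(filt_cofilt m); apply: capvS; first exact: capvSr.
apply/subvP => _ /memv_imgP[v /memv_capP[_ vm] ->].
exact: raising_cofilt.
Qed.

Lemma dim_raising W : \dim (u @: W) = \dim W.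
Proof. by apply: limg_dim_eq; rewrite (eqP ker_u) capv0. Qed.

(** Inside [u @: W], the part in [filt m] is independent of the image of [W :&: cofilt m], which
    stays in [cofilt m] and keeps its dimension. *)
Lemma dim_raising_filt W m : graded W ->
  (\dim (u @: W :&: filt m) <= \dim (W :&: filt m))%N.
Proof.
move=> gW; rewrite -(leq_add2r (\dim (W :&: cofilt m))) (graded_split m gW).
rewrite -(dim_raising (W :&: cofilt m)) -dimv_disjoint_sum ?raising_disjoint //.
by rewrite -(dim_raising W) dimvS // subv_add capvSl limgS // capvSl.
Qed.

Lemma weight_raising W : graded W -> (weight (u @: W) <= weight W)%N.
Proof. by move=> gW; apply: leq_sum => m _; apply: dim_raising_filt. Qed.

(* Comparing the parts of degree [k + a] in [u v = f + u g], where [g] in [W]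
   has degrees above [k] and [f] has degrees at most [k]. *)
Lemma raising_stable W : graded W -> weight (u @: W) = weight W ->
  forall v, v \in W -> x v \in W.
Proof.
move=> gW wE v vW.
(* No term of the sum [weight] can grow, so equal sums force equality term by term. *)
have dimE k : (k <= N)%N -> \dim (u @: W :&: filt k) = \dim (W :&: filt k).
  move=> kN.
  have /leqif_sum : forall m : 'I_N.+1, true -> (\dim (u @: W :&: filt m) <=
      \dim (W :&: filt m) ?= iff (\dim (u @: W :&: filt m) == \dim (W :&: filt m)))%N.
    by move=> m _; split=> //; apply: dim_raising_filt.
  case=> _; rewrite -/(weight _) -/(weight _) wE eqxx => /esym/forall_inP.
  by move=> /(_ (Ordinal (kN : k < N.+1)%N) isT) /eqP.
(* As [W] is graded, [v] may be taken homogeneous of degree [k]. *)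
rewrite -(component_sum pr v) linear_sum; apply: memv_suml => /= k _.
move: (pr k v) (gW k v vW) (componentK k v) => {vW}v vW vk.
(* Equality of dimensions makes the two independent pieces fill [u @: W]. *)
have : u v \in ((u @: W :&: filt k.+1) + (u @: (W :&: cofilt k.+1)))%VS.
  suff -> : ((u @: W :&: filt k.+1) + (u @: (W :&: cofilt k.+1)))%VS = (u @: W)%VS.
    exact: memv_img.
  apply/eqP; rewrite eqEdim subv_add capvSl limgS ?capvSl //=.
  rewrite dimv_disjoint_sum ?raising_disjoint // !dim_raising dimE //.
  by rewrite graded_split.
case/memv_addP => f /memv_capP[_ /filtP fk] [_ /memv_imgP[g /memv_capP[gW' /cofiltP gk] ->]].
have vl l : l != k -> pr l v = 0 by move=> lk; rewrite -vk component_comp (negPf lk).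
have k_ka : (k < k + a)%N by rewrite -addn1 leq_add2l.
move=> /(congr1 (pr (k + a)%N)); rewrite !uE !linearD /= -!x_component.
rewrite (fk (k + a)%N) // vk vl ?gtn_eqF // (gk k) // linear0 add0r addr0.
(* The part of [y w] in degree [k + a] comes from degree [k - a] of [w], below [k], or vanishes when
   [k < a]. *)
have y0 w : (forall l, (l < k)%N -> pr l w = 0) -> pr (k + a)%N (y w) = 0.
  move=> w0; have [aa|aa] := leqP (a + a)%N (k + a)%N.
    rewrite -(subnK aa) -y_component subnDr w0 ?linear0 //.
    by rewrite ltn_subrL a_gt0; move: aa; rewrite leq_add2r => /(leq_trans a_gt0).
  exact: (shift_below y_component).
rewrite !y0 ?addr0 ?add0r.
- by move=> ->; apply: gW.
- by move=> l lk; apply: gk; apply: ltnW.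
- by move=> l lk; apply: vl; rewrite ltn_eqF.
Qed.

End Raising.
End Gradings.

(** * Degeneration of a subspace to its initial subspace *)

Section Degeneration.
Variables (F : numFieldType) (V : vectType F) (N : nat) (pr : grading V N).

(** The action of [s] with weight [- k] in degree [k], multiplied by [s ^+ N] to make it polynomial
    in [s]. *)
Definition rescale (s : F) : 'End(V) := \sum_(k < N) s ^+ (N - k) *: pr k.

(** A linear section of [pr k] over the leading forms, obtained from a pseudo-inverse. *)
Definition lead_lift (W : {vspace V}) k : 'End(V) :=
  let P := projv (W :&: filt pr k.+1) in (P \o (pr k \o P)^-1)%VF.

Lemma lead_liftP (W : {vspace V}) k x : x \in lead pr W k ->
  lead_lift W k x \in (W :&: filt pr k.+1)%VS /\ pr k (lead_lift W k x) = x.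
Proof.
move=> xW; rewrite comp_lfunE; split; first exact: memv_proj.
rewrite -[pr k _](comp_lfunE (pr k) (projv _)) limg_lfunVK //.
case/memv_imgP: xW => w wW ->.
by apply/memv_imgP; exists w; rewrite ?memvf // comp_lfunE projv_id.
Qed.

(** Once normalised, the rescaling of a vector with top degree [k] is a polynomial in [s] whose
    constant term is its leading form. *)
Lemma rescale_filt s k w : s != 0 -> (k < N)%N -> w \in filt pr k.+1 ->
  \sum_(i < N | (i <= k)%N) s ^+ i *: pr (k - i)%N w =
    (s ^+ (N - k))^-1 *: rescale s w.
Proof.
move=> s0 kN /filtP wk; rewrite sum_lfunE scaler_sumr.
rewrite [RHS](bigID (fun j : 'I_N => j <= k)%N) /= [X in _ + X]big1 ?addr0; last first.
  by move=> j; rewrite -ltnNge => kj; rewrite scale_lfunE wk // !scaler0.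
(* Truncated subtraction sends every [i > k] to 0; these are excluded by the condition
   [r (r i) = i]. *)
pose r (i : 'I_N) : 'I_N := insubd i (k - i)%N.
have rE (i : 'I_N) : r i = (k - i)%N :> nat.
  by rewrite val_insubd (leq_ltn_trans (leq_subr i k) kN).
rewrite [RHS](reindex_onto r r) /=; last first.
  by move=> j jk; apply: val_inj; rewrite /= !rE subKn.
apply: eq_big => [i | i ik].
  rewrite rE leq_subr /=; apply/idP/idP => [ik | /eqP <-].
    by apply/eqP/val_inj; rewrite /= !rE subKn.
  by rewrite rE leq_subr.
rewrite rE scale_lfunE scalerA; congr (_ *: _).
rewrite (_ : N - (k - i) = i + (N - k))%N; last first.
  by rewrite subnBA // addnC -addnBA // ltnW.
by rewrite exprD mulrC mulfK // expf_neq0.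
Qed.

(* The family [h s] deforms the identity, carries [initial W] onto the
   rescaled [W], and commutes with [g] on [initial W]. *)
Lemma degeneration (W : {vspace V}) (g : 'End(V)) : lker g == 0%VS ->
    (initial pr W :&: g @: initial pr W = 0)%VS ->
  exists2 s : F, s != 0 &
    ((rescale s @: W) :&: g @: (rescale s @: W) = 0)%VS.
Proof.
move=> g0; set X := initial pr W => XgX.
have := @lead_liftP W; move: (lead_lift W) => tau tauP.
pose th i : 'End(V) := \sum_(k < N | (i <= k)%N) (pr (k - i)%N \o (tau k \o pr k))%VF.
(* [theta s] lifts each component of a vector of [X] to [W] and rescales the lift; its constant term
   is the identity on [X]. *)
pose theta s : 'End(V) := \sum_(i < N) s ^+ i *: th i.
have leadX k x : x \in X -> pr k x \in lead pr W k by apply: component_initial.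
have theta_im s x : s != 0 -> x \in X -> theta s x \in (rescale s @: W)%VS.
  move=> s0 xX; rewrite sum_lfunE.
  under eq_bigr => i _ do rewrite scale_lfunE sum_lfunE scaler_sumr big_mkcond.
  rewrite exchange_big /=; apply: memv_suml => k _.
  under eq_bigr => i _ do rewrite !comp_lfunE.
  rewrite -big_mkcond /=.
  have [/memv_capP[tW tk] _] := tauP _ _ (leadX k x xX).
  by rewrite rescale_filt // memvZ // memv_img.
have th0 x : x \in X -> th 0 x = x.
  move=> xX; rewrite sum_lfunE -[RHS](component_sum pr x); apply: eq_bigr => k _.
  by rewrite !comp_lfunE subn0; case: (tauP _ _ (leadX k x xX)).
(* [lker0_family] sums one term more than [theta]. *)
have thN x : th N x = 0.
  rewrite sum_lfunE big1 // => k Nk; by move: (ltn_ord k); rewrite ltnNge Nk.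
pose p1 := daddv_pi X (g @: X); pose p2 := daddv_pi (g @: X) X.
have gXX : (g @: X :&: X = 0)%VS by rewrite capvC.
(* This is [theta] on [X] and its conjugate by [g] on [g @: X]; the last summand completes the
   constant term to the identity. *)
pose h i : 'End(V) := ((th i \o p1) + (g \o (th i \o (g^-1 \o p2))))%VF +
  (if i == 0 then \1%VF - p1 - p2 else 0).
have h0 : h 0 = \1%VF.
  apply/lfunP => v; rewrite /h eqxx !add_lfunE !opp_lfunE !comp_lfunE.
  rewrite th0 ?memv_pi //; have /memv_imgP[x xX p2v] : p2 v \in (g @: X)%VS by apply: memv_pi.
  rewrite p2v lker0_lfunK // th0 //.
  by rewrite -p2v id_lfunE addrC -[v - _ - _]addrA -opprD subrK.
have [s s0 ker_h] := lker0_family N h0; exists s => //.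
set H := \sum_(i < N.+1) _ in ker_h.
have thetaE x : theta s x = \sum_(i < N.+1) s ^+ i *: th i x.
  rewrite sum_lfunE big_ord_recr /= thN scaler0 addr0.
  by apply: eq_bigr => i _; rewrite scale_lfunE.
have p1E x : x \in X -> p1 x = x by move=> xX; apply: daddv_pi_id.
have p2E x : x \in X -> p2 x = 0.
  move=> xX; have := daddv_pi_add XgX (subvP (addvSl X (g @: X)) _ xX).
  by rewrite -/p1 -/p2 p1E // => /(canRL (addKr _)) ->; rewrite addNr.
have p2gE x : x \in X -> p2 (g x) = g x.
  by move=> xX; apply: daddv_pi_id => //; apply: memv_img.
have p1gE x : x \in X -> p1 (g x) = 0.
  move=> xX; have := daddv_pi_add XgX (subvP (addvSr X (g @: X)) _ (memv_img g xX)).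
  by rewrite -/p1 -/p2 p2gE // => /(canRL (addrK _)) ->; rewrite subrr.
have HX x : x \in X -> H x = theta s x.
  move=> xX; rewrite sum_lfunE thetaE; apply: eq_bigr => i _.
  rewrite scale_lfunE /h !add_lfunE !comp_lfunE p1E // p2E // !linear0 addr0.
  by case: eqP => _; rewrite ?zero_lfunE ?add_lfunE ?opp_lfunE ?id_lfunE ?p1E ?p2E // ?subrr ?subr0 ?addr0.
have HgX x : x \in X -> H (g x) = g (theta s x).
  move=> xX; rewrite sum_lfunE thetaE linear_sum; apply: eq_bigr => i _.
  rewrite scale_lfunE /h !add_lfunE !comp_lfunE p1gE // p2gE // !linear0 add0r.
  rewrite lker0_lfunK // linearZ /=.
  by case: eqP => _; rewrite ?zero_lfunE ?add_lfunE ?opp_lfunE ?id_lfunE ?p1gE ?p2gE // ?subr0 ?subrr ?addr0.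
(* The inclusion is an equality because [H] is injective and [rescale s] cannot raise the dimension
   of [W]. *)
have H_X : (H @: X = rescale s @: W)%VS.
  apply/eqP; rewrite eqEdim; apply/andP; split.
    by apply/subvP => _ /memv_imgP[x xX ->]; rewrite HX // theta_im.
  rewrite (@limg_dim_eq _ _ _ H) ?(eqP ker_h) ?capv0 // dim_initial.
  by rewrite -(limg_ker_dim (rescale s) W) leq_addl.
have H_gX : (H @: (g @: X) = g @: (rescale s @: W))%VS.
  by rewrite -H_X -!limg_comp; apply: eq_in_limg => x xX; rewrite !comp_lfunE HgX // HX.
by rewrite -H_gX -H_X -lker0_img_cap // XgX limg0.
Qed.

End Degeneration.

(** * Matrix units, their adjoint action and conjugations *)

Section MatrixUnits.
Variables (F : fieldType) (n : nat).
Implicit Types (A : 'M[F]_n) (i j k l : 'I_n).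

Lemma delta_mulmxE i j A k l : (delta_mx i j *m A) k l = (k == i)%:R * A j l.
Proof.
rewrite mxE (bigD1 j) //= big1 ?addr0 => [|m /negPf mj]; rewrite mxE.
  by rewrite eqxx andbT.
by rewrite mj andbF mul0r.
Qed.

Lemma mulmx_deltaE i j A k l : (A *m delta_mx i j) k l = A k i * (l == j)%:R.
Proof.
rewrite mxE (bigD1 i) //= big1 ?addr0 => [|m /negPf mj]; rewrite mxE.
  by rewrite eqxx.
by rewrite mj mulr0.
Qed.

Definition ad_unit i j : 'End('M[F]_n) :=
  linfun (mulmx (delta_mx i j)) - linfun (mulmxr (delta_mx i j)).

Lemma ad_unitE i j A : ad_unit i j A = delta_mx i j *m A - A *m delta_mx i j.
Proof. by rewrite add_lfunE opp_lfunE !lfunE. Qed.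

Definition sandwich (h k : 'M[F]_n) : 'End('M[F]_n) :=
  linfun (mulmxr k \o mulmx h).

Lemma sandwichE (h k : 'M[F]_n) A : sandwich h k A = h *m A *m k.
Proof. by rewrite lfunE. Qed.

Lemma sandwich_inj (h k : 'M[F]_n) : h *m k = 1%:M -> injective (sandwich h k).
Proof.
move=> hk A B; have kh := mulmx1C hk.
rewrite !sandwichE => /(congr1 (fun C => k *m C *m h)).
by rewrite !mulmxA kh !mul1mx -!mulmxA kh !mulmx1.
Qed.

Lemma lker_sandwich (h k : 'M[F]_n) : h *m k = 1%:M -> lker (sandwich h k) == 0%VS.
Proof. by move=> hk; apply/lker0P/sandwich_inj. Qed.

Lemma elementary_inverse i j : i != j ->
  (1%:M + delta_mx i j) *m (1%:M - delta_mx i j) = 1%:M :> 'M[F]_n.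
Proof.
move=> ij; rewrite mulmxDl !mulmxBr !mul1mx mulmx1 mul_delta_mx_0 1?eq_sym //.
by rewrite subr0 subrK.
Qed.

(** This puts conjugation by [1 + E_ij] in the form [v + x v + y v] of a raising operator. *)
Lemma elementary_sandwichE i j A :
  sandwich (1%:M + delta_mx i j) (1%:M - delta_mx i j) A =
    A + ad_unit i j A + (- sandwich (delta_mx i j) (delta_mx i j)) A.
Proof.
rewrite opp_lfunE !sandwichE ad_unitE mulmxDl mul1mx mulmxBr mulmx1 mulmxDl opprD.
by rewrite !addrA; congr (_ - _); rewrite addrAC.
Qed.

Lemma mxtrace_sandwich (h k : 'M[F]_n) A : h *m k = 1%:M -> \tr (sandwich h k A) = \tr A.
Proof. by move=> /mulmx1C kh; rewrite sandwichE mxtrace_mulC mulmxA kh mul1mx. Qed.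

End MatrixUnits.

(** * A degree that separates the off-diagonal matrix units *)

Section Degree.
Variable n : nat.
Implicit Types i j k l : 'I_n.

(* The weight of the matrix unit [(i, j)] under [diag(s ^ -(2 ^ i))], shifted
   by [2 ^ n] to be a natural number. *)
Definition deg i j : nat := (2 ^ n + 2 ^ j - 2 ^ i)%N.

Lemma exp2_le_ord i : (2 ^ i <= 2 ^ n)%N.
Proof. by rewrite leq_exp2l // ltnW. Qed.

Lemma deg_lt i j : (deg i j < 2 ^ n + 2 ^ n)%N.
Proof.
have := exp2_le_ord j; have := exp2_le_ord i.
have : (0 < 2 ^ i)%N by rewrite expn_gt0.
by rewrite /deg; lia.
Qed.

(** For [a <= b] the sum lies above [2 ^ b] and is at most [2 ^ b.+1], which determines [b]. *)
Lemma exp2_sum_inj a b c d : (2 ^ a + 2 ^ b = 2 ^ c + 2 ^ d)%N ->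
  (a = c /\ b = d) \/ (a = d /\ b = c).
Proof.
wlog ab : a b / (a <= b)%N => [th|].
  case: (leqP a b) => [/th //|/ltnW /th t]; rewrite addnC => /t.
  by case=> [] []; [right | left].
wlog cd : c d / (c <= d)%N => [th|].
  case: (leqP c d) => [/th //|/ltnW /th t]; rewrite [RHS]addnC => /t.
  by case=> [] []; [right | left].
have lt_sum x y z : (x <= y)%N -> (y < z)%N -> (2 ^ x + 2 ^ y <= 2 ^ z)%N.
  move=> xy yz; apply: (@leq_trans (2 ^ y.+1)); last by rewrite leq_exp2l.
  by rewrite expnS mul2n -addnn leq_add2r leq_exp2l.
move=> E; have c0 : (0 < 2 ^ c)%N by rewrite expn_gt0.
have a0 : (0 < 2 ^ a)%N by rewrite expn_gt0.
have [bd|db|bd] := ltngtP b d.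
- by have := lt_sum _ _ _ ab bd; lia.
- by have := lt_sum _ _ _ cd db; lia.
- move: E; rewrite bd => /eqP; rewrite eqn_add2r eqn_exp2l // => /eqP; left.
  by split.
Qed.

Lemma deg_inj i j k l : i != j -> deg i j = deg k l -> i = k /\ j = l.
Proof.
move=> ij; rewrite /deg => E.
have {}E : (2 ^ j + 2 ^ k = 2 ^ l + 2 ^ i)%N.
  by have := exp2_le_ord i; have := exp2_le_ord k; move: E; lia.
case: (exp2_sum_inj E) => [[jl ki]|[ji _]]; first by split; apply: val_inj.
by move: ij; rewrite (val_inj ji) eqxx.
Qed.

Lemma deg_diag i : deg i i = (2 ^ n)%N.
Proof. by rewrite /deg addnK. Qed.

End Degree.

(** * The resulting grading of the matrix space *)

Section MatrixGrading.
Variables (F : numFieldType) (n : nat).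
Implicit Types (A B : 'M[F]_n) (i j k l : 'I_n) (W X : {vspace 'M[F]_n}).

Definition deg_part (d : nat) A : 'M[F]_n :=
  \matrix_(i, j) (if deg i j == d then A i j else 0).

Fact deg_part_is_linear d : linear (deg_part d).
Proof.
move=> c A B; apply/matrixP => i j; rewrite !mxE.
by case: ifP; rewrite ?mulr0 ?addr0.
Qed.
HB.instance Definition _ d :=
  GRing.isLinear.Build F _ _ *:%R _ (deg_part_is_linear d).

Fact deg_part_comp d e A :
  linfun (deg_part d) (linfun (deg_part e) A) =
    if d == e then linfun (deg_part d) A else 0.
Proof.
rewrite !lfunE; apply/matrixP => i j; rewrite !mxE (eq_sym d).
case: (eqVneq e d) => [->|ed]; rewrite !mxE; case: eqP => // ->.
by rewrite eq_sym (negPf ed).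
Qed.

Fact deg_part_sum A : \sum_(d < 2 ^ n + 2 ^ n) linfun (deg_part d) A = A.
Proof.
apply/matrixP => i j; rewrite summxE (bigD1 (Ordinal (deg_lt i j))) //=.
rewrite lfunE mxE eqxx big1 ?addr0 // => d /negPf dij; rewrite lfunE mxE eq_sym.
by move: dij; rewrite -val_eqE /= => ->.
Qed.

Definition mx_grading : grading 'M[F]_n (2 ^ n + 2 ^ n) :=
  Grading deg_part_comp deg_part_sum.

Lemma mx_gradingE d A i j :
  mx_grading d A i j = if deg i j == d then A i j else 0.
Proof. by rewrite lfunE mxE. Qed.

Lemma mxtrace_grading d A : \tr A = 0 -> \tr (mx_grading d A) = 0.
Proof.
move=> A0; have [->|d0] := eqVneq d (2 ^ n)%N.
  by rewrite -[RHS]A0; apply: eq_bigr => i _; rewrite mx_gradingE deg_diag eqxx.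
by rewrite /mxtrace big1 // => i _; rewrite mx_gradingE deg_diag eq_sym (negPf d0).
Qed.

(** By [deg_inj] the component of [A] in degree [deg i j] is the single term
    [A i j *: delta_mx i j]. *)
Lemma graded_delta X A i j : graded mx_grading X ->
  i != j -> A \in X -> A i j != 0 -> delta_mx i j \in X.
Proof.
move=> gX ij AX Aij.
suff -> : delta_mx i j = (A i j)^-1 *: mx_grading (deg i j) A by apply/memvZ/gX.
apply/matrixP => k l; rewrite !mxE mx_gradingE.
case: (eqVneq (deg k l) (deg i j)) => [/esym E|E].
  by have [<- <-] := deg_inj ij E; rewrite !eqxx mulVf.
by rewrite mulr0; case: andP E => // -[/eqP -> /eqP ->]; rewrite eqxx.
Qed.

Section Ad.
Variables i j : 'I_n.
Hypothesis ij : (i < j)%N.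
Let a := (2 ^ j - 2 ^ i)%N.

Lemma deg_shift_gt0 : (0 < a)%N.
Proof. by rewrite subn_gt0 ltn_exp2l. Qed.

Lemma deg_shift_row k : deg i k = (deg j k + a)%N.
Proof.
have := deg_shift_gt0; have := exp2_le_ord i; have := exp2_le_ord j.
by rewrite /deg /a; lia.
Qed.

Lemma deg_shift_col k : deg k j = (deg k i + a)%N.
Proof.
have := deg_shift_gt0; have := exp2_le_ord i; have := exp2_le_ord k.
by rewrite /deg /a; lia.
Qed.

(** Left multiplication by [E_ij] moves row [j] to row [i], right multiplication moves column [i] to
    column [j]; both moves raise the degree by [a]. *)
Lemma ad_unit_grading d A :
  ad_unit F i j (mx_grading d A) = mx_grading (d + a)%N (ad_unit F i j A).
Proof.
apply/matrixP => k l; rewrite mx_gradingE !ad_unitE [LHS]mxE.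
rewrite [X in _ = if _ then X else _]mxE [X in _ + X = _]mxE.
rewrite [X in _ = if _ then _ + X else _]mxE.
rewrite !delta_mulmxE !mulmx_deltaE !mx_gradingE.
have [->|_] := eqVneq k i; have [->|_] := eqVneq l j;
  rewrite ?mul0r ?mulr0 ?mul1r ?mulr1 ?oppr0 ?addr0 ?add0r ?if_same //;
  rewrite ?(deg_shift_row, deg_shift_col) ?eqn_add2r //.
  by case: eqP; rewrite ?subr0.
by case: eqP; rewrite ?oppr0.
Qed.

Lemma sandwich_unit_grading d A :
  (- sandwich (delta_mx i j) (delta_mx i j)) (mx_grading d A) =
  mx_grading (d + (a + a))%N ((- sandwich (delta_mx i j) (delta_mx i j)) A).
Proof.
apply/matrixP => k l; rewrite mx_gradingE !opp_lfunE !sandwichE.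
rewrite [LHS]mxE [X in _ = if _ then X else _]mxE.
rewrite !mulmx_deltaE !delta_mulmxE !mx_gradingE.
have [->|_] := eqVneq k i; have [->|_] := eqVneq l j;
  rewrite ?mul0r ?mulr0 ?mul0r ?mul1r ?mulr1 ?oppr0 ?if_same //.
by rewrite deg_shift_row deg_shift_col -addnA eqn_add2r; case: ifP; rewrite ?oppr0.
Qed.

End Ad.
End MatrixGrading.

(** * Separability and the descent to Borel-stable subspaces *)

Section Separation.
Variables (F : numFieldType) (n : nat).
Implicit Types (A B h : 'M[F]_n) (i j : 'I_n) (W X : {vspace 'M[F]_n}).

(** The conjugator is any invertible matrix; determinant 1 is arranged only at the end. *)
Definition separable W := exists h k : 'M[F]_n,
  h *m k = 1%:M /\ forall A, A \in W -> h *m A *m k \in W -> A = 0.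

Lemma separable_sandwich W (h k : 'M[F]_n) : h *m k = 1%:M ->
  separable (sandwich h k @: W) -> separable W.
Proof.
move=> hk [p [q [pq sep]]]; have kh := mulmx1C hk.
exists (k *m p *m h), (k *m q *m h); split.
  by rewrite !mulmxA -(mulmxA _ h k) hk mulmx1 -(mulmxA k p q) pq mulmx1.
move=> A AW BW; apply: (sandwich_inj hk).
rewrite linear0; apply: sep; first exact: memv_img.
have := memv_img (sandwich h k) BW; rewrite !sandwichE !mulmxA hk mul1mx.
by rewrite -!mulmxA hk mulmx1.
Qed.

Definition torus (s : F) : 'M[F]_n := diag_mx (\row_i s ^+ (2 ^ i)).

Lemma torusV s : s != 0 -> torus s *m torus s^-1 = 1%:M.
Proof.
move=> s0; rewrite mulmx_diag -diag_const_mx; congr diag_mx; apply/rowP => i.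
by rewrite !mxE exprVn divff // expf_neq0.
Qed.

(** The exponent [2 ^ n + 2 ^ n - deg i j] is [2 ^ n + 2 ^ i - 2 ^ j], and the torus acts on entry
    [(i, j)] by [2 ^ i - 2 ^ j]. *)
Lemma rescale_torus s A : s != 0 ->
  rescale (mx_grading F n) s A =
    s ^+ (2 ^ n) *: sandwich (torus s) (torus s^-1) A.
Proof.
move=> s0; rewrite sandwichE mul_diag_mx mul_mx_diag sum_lfunE.
apply/matrixP => i j; rewrite summxE (bigD1 (Ordinal (deg_lt i j))) //=.
rewrite scale_lfunE mxE mx_gradingE eqxx big1 ?addr0 => [|d /negPf dij]; last first.
  rewrite scale_lfunE mxE mx_gradingE eq_sym.
  by move: dij; rewrite -val_eqE /= => ->; rewrite mulr0.
have := exp2_le_ord i; have := exp2_le_ord j => jn iN.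
have -> : (2 ^ n + 2 ^ n - deg i j = (2 ^ n - 2 ^ j) + 2 ^ i)%N by rewrite /deg; lia.
by rewrite !mxE exprD exprB ?unitfE // exprVn; ring.
Qed.

(** [degeneration] separates the rescaled [W]; as rescaling is a torus conjugation up to a scalar,
    conjugating [h] by the torus separates [W] itself. *)
Lemma separable_initial W :
  separable (initial (mx_grading F n) W) -> separable W.
Proof.
case=> h [k [hk sep]].
have [|s s0 disj] := degeneration (pr := mx_grading F n) (W := W) (lker_sandwich hk).
  apply/eqP; rewrite -subv0; apply/subvP => B /memv_capP[BX /memv_imgP[A AX E]].
  by rewrite memv0 E (sep A) ?linear0 // -sandwichE -E.
pose D := torus s; pose D' := torus s^-1.
have DD' : D *m D' = 1%:M by apply: torusV.
have D'D := mulmx1C DD'.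
exists (D' *m h *m D), (D' *m k *m D); split.
  by rewrite !mulmxA -(mulmxA _ D D') DD' mulmx1 -(mulmxA D' h k) hk mulmx1.
move=> A AW BW; set B := _ *m _ in BW.
suff RA0 : rescale (mx_grading F n) s A = 0.
  apply: (sandwich_inj DD'); rewrite linear0; apply/eqP.
  by move/eqP: RA0; rewrite rescale_torus // scaler_eq0 expf_eq0 (negPf s0) andbF.
have RB : rescale (mx_grading F n) s B = sandwich h k (rescale (mx_grading F n) s A).
  rewrite !rescale_torus // linearZ /=; congr (_ *: _); rewrite !sandwichE /B.
  rewrite -/D -/D' !mulmxA DD' mul1mx -!mulmxA.
  by congr (_ *m (_ *m (_ *m _))); rewrite DD' mulmx1.
apply: (sandwich_inj hk); rewrite linear0 -RB; apply/eqP.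
rewrite -memv0 -disj memv_cap memv_img //= RB.
by apply: memv_img; apply: memv_img.
Qed.

Definition ad_stable X := forall i j, (i < j)%N -> forall A, A \in X ->
  delta_mx i j *m A - A *m delta_mx i j \in X.

Definition traceless W := forall A, A \in W -> \tr A = 0.

Lemma traceless_initial W : traceless W -> traceless (initial (mx_grading F n) W).
Proof.
move=> W0 A AX; rewrite -(component_sum (mx_grading F n) A).
rewrite linear_sum big1 //= => d _.
have /memv_imgP[B /memv_capP[/W0 BW _] ->] := component_initial d AX.
exact: mxtrace_grading.
Qed.

(** Induction on [weight], which passing to [initial W] preserves. Either some conjugation by
    [1 + E_ij] lowers it, or equality holds for all [i < j] and [raising_stable] gives stability. *)
Lemma separable_by_descent m :
    (forall X, graded (mx_grading F n) X -> ad_stable X -> traceless X ->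
       \dim X = m -> separable X) ->
  forall W, traceless W -> \dim W = m -> separable W.
Proof.
move=> borel W; have [w] := ubnP (weight (mx_grading F n) W).
elim: w W => // w IHw W; rewrite ltnS => Ww W0 Wm.
apply: separable_initial; set X := initial _ W.
have gX : graded (mx_grading F n) X by apply: initial_graded.
have X0 : traceless X by apply: traceless_initial.
have Xm : \dim X = m by rewrite dim_initial.
pose u i j : 'End('M[F]_n) := sandwich (1%:M + delta_mx i j) (1%:M - delta_mx i j).
have u_inv i j : (i < j)%N -> (1%:M + delta_mx i j) *m (1%:M - delta_mx i j) = 1%:M :> 'M[F]_n.
  by move=> ij; apply: elementary_inverse; rewrite -val_eqE /= ltn_eqF.
case: (boolP [exists p : 'I_n * 'I_n, (p.1 < p.2)%N &&
    (weight (mx_grading F n) (u p.1 p.2 @: X) < weight (mx_grading F n) X)%N]).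
  case/existsP => -[i j] /= /andP[ij lt_w]; apply: (separable_sandwich (u_inv i j ij)).
  apply: IHw.
  - by apply: leq_trans lt_w _; rewrite weight_initial.
  - by move=> _ /memv_imgP[A AX ->]; rewrite mxtrace_sandwich ?u_inv // X0.
  - by rewrite limg_dim_eq // (eqP (lker_sandwich (u_inv i j ij))) capv0.
move=> no_drop; apply: borel => // i j ij A AX; rewrite -ad_unitE.
apply: (raising_stable (deg_shift_gt0 ij) (elementary_sandwichE i j)
  (ad_unit_grading ij) (sandwich_unit_grading ij) (lker_sandwich (u_inv i j ij))
  gX) AX.
apply/eqP; rewrite eqn_leq; apply/andP; split.
  exact: (weight_raising (elementary_sandwichE i j)
    (ad_unit_grading ij) (sandwich_unit_grading ij) (lker_sandwich (u_inv i j ij)) gX).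
rewrite leqNgt; apply: contra no_drop => lt_w.
by apply/existsP; exists (i, j); rewrite ij.
Qed.

End Separation.

(** * Dimension bounds from matrix units in a subspace *)

Section UnitsInSubspace.
Variables (F : fieldType) (n : nat).
Implicit Types (A B : 'M[F]_n) (i j : 'I_n) (X : {vspace 'M[F]_n}).

Lemma span_entry0 (s : seq 'M[F]_n) i j A :
  (forall B, B \in s -> B i j = 0) -> A \in <<s>>%VS -> A i j = 0.
Proof.
move=> s0 As; rewrite (coord_span (X := in_tuple s) As) summxE big1 // => k _.
by rewrite mxE s0 ?mulr0 // mem_nth // size_tuple.
Qed.

Definition units_seq (s : seq ('I_n * 'I_n)) : seq 'M[F]_n :=
  [seq delta_mx p.1 p.2 | p <- s].

Lemma free_units_seq s : uniq s -> free (units_seq s).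
Proof.
elim: s => [|[i j] s IHs] /=; first by rewrite nil_free.
case/andP => ij /IHs free_s; rewrite free_cons free_s andbT.
apply/negP => /(span_entry0 (i := i) (j := j)); rewrite mxE !eqxx => E.
suff /eqP : (1 : F) = 0 by rewrite oner_eq0.
apply: E => _ /mapP[[k l] kl ->]; rewrite mxE /=.
by case: eqP ij => [->|] //=; case: eqP => [->|] //; rewrite kl.
Qed.

Lemma card_units_leq_dim (S : {set 'I_n * 'I_n}) X :
  (forall p, p \in S -> delta_mx p.1 p.2 \in X) -> (#|S| <= \dim X)%N.
Proof.
move=> SX; have /eqP : free (units_seq (enum S)) by rewrite free_units_seq ?enum_uniq.
rewrite size_map -cardE => <-; apply/dimvS/span_subvP => _ /mapP[p pS ->].
by apply: SX; rewrite mem_enum in pS.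
Qed.

(** The off-diagonal units vanish at [(i, i)] and [A] does not, so [A] adds one dimension. *)
Lemma card_units_lt_dim (S : {set 'I_n * 'I_n}) X A i :
  (forall p, p \in S -> p.1 != p.2) ->
  (forall p, p \in S -> delta_mx p.1 p.2 \in X) ->
  A \in X -> A i i != 0 -> (#|S| < \dim X)%N.
Proof.
move=> offdiag SX AX Ai.
have : free (A :: units_seq (enum S)).
  rewrite free_cons free_units_seq ?enum_uniq // andbT; apply: contra Ai.
  move=> /(span_entry0 (i := i) (j := i)) => ->//.
  move=> _ /mapP[[k l] kl ->]; rewrite mem_enum in kl; rewrite mxE /=.
  have := offdiag _ kl; rewrite /=.
  by case: (eqVneq i k) => [->|] //=; case: (eqVneq k l).
move/eqP; rewrite /= size_map -cardE => <-; apply/dimvS/span_subvP => B.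
rewrite inE => /predU1P[-> //|/mapP[p pS ->]].
by apply: SX; rewrite mem_enum in pS.
Qed.

End UnitsInSubspace.

(** * Counting rectangles and unordered pairs of indices *)

Lemma card_ord_lt n a : (a <= n)%N -> #|[set i : 'I_n | (i < a)%N]| = a.
Proof.
by move=> an; rewrite cardsE -sum1_card -(big_ord_widen n (fun=> 1%N)) // sum1_card card_ord.
Qed.

(** For [0 < a = b < n] these are the positions of the positive roots above the simple root
    [(a - 1, a)]. *)
Definition rectangle n (a b : nat) : {set 'I_n * 'I_n} :=
  setX [set i : 'I_n | (i < a)%N] [set j : 'I_n | (b <= j)%N].

Lemma card_rectangle n a b : (a <= n)%N -> (b <= n)%N ->
  #|rectangle n a b| = (a * (n - b))%N.
Proof.
move=> an bn; rewrite cardsX card_ord_lt //; congr (_ * _)%N.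
rewrite cardsCs card_ord -[in RHS](card_ord_lt bn).
by congr (_ - #|pred_of_set _|)%N; apply/setP => j; rewrite !inE -ltnNge.
Qed.

(** For [p <= q] the right side minus the left is [(p - 1) * (2 * q - p - 3)], negative only at
    [p = q = 2]; this is where [n = 4] drops out. *)
Lemma two_rectangles_bound p q : (0 < p)%N -> (0 < q)%N -> (p + q)%N <> 4 ->
  (2 * (p + q) + minn p q * minn p q <= 2 * (p * q) + 3)%N.
Proof.
wlog pq : p q / (p <= q)%N => [th|] p0 q0 n4.
  case/orP: (leq_total p q) => pq; first exact: th.
  by rewrite [(p + q)%N]addnC minnC [(p * q)%N]mulnC; apply: th; rewrite // addnC.
rewrite (minn_idPl pq).
case: p p0 pq n4 => [//|[|[|p]]] _ pq n4; [lia | lia |].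
rewrite -(subnKC pq); move: (q - _)%N => r; nia.
Qed.

Definition ordered_pair n (k l : 'I_n) := if (k < l)%N then (k, l) else (l, k).

Lemma ordered_pair_eq n (a b i j : 'I_n) :
  ordered_pair a j = ordered_pair b i -> (a = b /\ j = i) \/ (a = i /\ j = b).
Proof.
rewrite /ordered_pair.
by case: ifP => _; case: ifP => _ [-> ->]; auto.
Qed.

Lemma ordered_pair_le n (a b : 'I_n) :
  ((ordered_pair a b).1 <= (ordered_pair a b).2)%N.
Proof. by rewrite /ordered_pair; case: ltnP => // /ltnW. Qed.

Lemma ordered_pair_inj n (m : 'I_n) : injective (@ordered_pair n ^~ m).
Proof. by move=> a b /ordered_pair_eq[[]|[-> <-]]. Qed.

(** * Subspaces stable under the positive root vectors *)

Section BorelStable.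
Variables (F : numFieldType) (n : nat) (X : {vspace 'M[F]_n}).
Implicit Types (A B z : 'M[F]_n) (i j k l : 'I_n).
Hypothesis adX : ad_stable X.

Lemma stable_row i j l : i != l -> (i < j)%N ->
  delta_mx j l \in X -> delta_mx i l \in X.
Proof.
move=> il ij /(adX ij); rewrite mul_delta_mx mul_delta_mx_0 1?eq_sym //.
by rewrite subr0.
Qed.

Lemma stable_col i j k : k != j -> (i < j)%N ->
  delta_mx k i \in X -> delta_mx k j \in X.
Proof.
move=> kj ij /(adX ij); rewrite mul_delta_mx mul_delta_mx_0 1?eq_sym //.
by rewrite sub0r memvN.
Qed.

(** For diagonal [z] the bracket [[E_kl, z]] is [(z l l - z k k) *: E_kl]. *)
Lemma stable_diag z k l : (forall i j, i != j -> z i j = 0) -> z \in X ->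
  (k < l)%N -> z k k != z l l -> delta_mx k l \in X.
Proof.
move=> zd zX kl zkl; have := adX kl zX.
suff -> : delta_mx k l *m z - z *m delta_mx k l = (z l l - z k k) *: delta_mx k l.
  move=> /(memvZ (z l l - z k k)^-1); rewrite scalerA mulVf ?scale1r //.
  by rewrite subr_eq0 eq_sym.
apply/matrixP => i j; rewrite mxE [X in _ + X = _]mxE delta_mulmxE mulmx_deltaE !mxE.
have [->|ik] := eqVneq i k; have [->|jl] := eqVneq j l;
  rewrite ?mul0r ?mulr0 ?mul1r ?mulr1 ?subr0 ?sub0r //.
- by rewrite zd 1?eq_sym.
- by rewrite zd ?oppr0.
Qed.

Lemma stable_coroot i j : (j < i)%N -> delta_mx i j \in X ->
  delta_mx j j - delta_mx i i \in X.
Proof. by move=> ji /(adX ji); rewrite !mul_delta_mx. Qed.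

(* All the positive roots meeting [{i, j}] follow from the coroot; there are
   [2 * n - 3] of them. *)
Lemma lower_unit_dim i j : (j < i)%N -> delta_mx i j \in X ->
  (n + n <= \dim X + 2)%N.
Proof.
move=> ji ijX; have ij : i != j by rewrite -val_eqE gtn_eqF.
have hX := stable_coroot ji ijX; set h := _ - _ in hX.
have hE k l : h k l = (if k == l then (if k == j then 1 else if k == i then -1 else 0) else 0).
  rewrite !mxE; case: (eqVneq k l) => [<-|kl].
    rewrite !andbb; case: (eqVneq k j) => [->|_]; first by rewrite eq_sym (negPf ij) subr0.
    by case: eqP; rewrite ?subr0 ?sub0r.
  have kk m : (k == m) && (l == m) = false.
    by case: eqP => // <-; rewrite eq_sym (negPf kl).
  by rewrite !kk subr0.
have hd k l : k != l -> h k l = 0 by rewrite hE => /negPf ->.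
(* In characteristic zero the coroot entries 1, -1 and 0 are distinct, so it has unequal entries on
   every pair meeting [{i, j}]. *)
have two0 : 1 != -1 :> F by rewrite -subr_eq0 opprK -[1 + 1]/(2%:R) pnatr_eq0.
have m10 : -1 != 0 :> F by rewrite oppr_eq0 oner_eq0.
have m11 : -1 != 1 :> F by rewrite eq_sym.
have o0 : 1 != 0 :> F by rewrite oner_eq0.
have zo : 0 != 1 :> F by rewrite eq_sym.
have zm : 0 != -1 :> F by rewrite eq_sym.
have toX k l : (k < l)%N -> h k k != h l l -> delta_mx k l \in X.
  exact: stable_diag.
(* The pair [{i, j}] is already counted in [S1], so [f j] is the lower position [(i, j)]; together
   this gives [2 * n - 2] units. *)
pose f k := if k == j then (i, j) else ordered_pair k i.
pose S1 := [set ordered_pair k j | k in [set~ j]]; pose S2 := [set f k | k in [set~ i]].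
have ij_unordered a b : (i, j) <> ordered_pair a b.
  by move=> E; have := ordered_pair_le a b; rewrite -E /= leqNgt ji.
have f_inj : {in [set~ i] &, injective f}.
  move=> a b _ _; rewrite /f; case: eqP => [->|_]; case: eqP => [->|_] //.
  - by move/ij_unordered.
  - by move/esym/ij_unordered.
  - exact: ordered_pair_inj.
have disj : [disjoint S1 & S2].
  apply/pred0P => p /=; apply/negP => /andP[/imsetP[a _ ->] /imsetP[b _]].
  rewrite /f; case: eqP => [_ /esym/ij_unordered //|bj].
  by case/ordered_pair_eq => -[_ E]; [rewrite E eqxx in ij | case: bj].
have SX p : p \in S1 :|: S2 -> delta_mx p.1 p.2 \in X.
  rewrite inE => /orP[] /imsetP[k]; rewrite !inE => kj ->; rewrite /f /ordered_pair.
    case: ltnP => [?|jk] /=; apply: toX; rewrite ?hE ?eqxx ?(negPf kj) //.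
    - by case: ifP.
    - by rewrite ltn_neqAle jk andbT val_eqE eq_sym.
    - by case: ifP.
  case: (eqVneq k j) => [_ //|kj'].
  case: ltnP => [?|jk] /=; apply: toX; rewrite ?hE ?eqxx ?(negPf kj) ?(negPf kj') ?(negPf ij) //.
  - by rewrite ltn_neqAle jk andbT val_eqE eq_sym.
have := card_units_leq_dim SX.
rewrite cardsU disjoint_setI0 // cards0 subn0 card_imset ?card_in_imset //; last exact: ordered_pair_inj.
rewrite !cardsC1 card_ord.
have n_gt0 : (0 < n)%N by apply: leq_ltn_trans (ltn_ord i).
by move: (\dim X : nat) n_gt0; clear => m; lia.
Qed.

(** First the row goes up from [k] to [i], then the column from [l] to [j]; since [i <= k < l <= j],
    the units stay off the diagonal. *)
Lemma stable_rectangle k l i j : delta_mx k l \in X -> l = k.+1 :> nat ->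
  (i <= k)%N -> (l <= j)%N -> delta_mx i j \in X.
Proof.
move=> klX lk ik lj.
have ilX : delta_mx i l \in X.
  have [/val_inj-> //|ik'] := eqVneq (i : nat) k.
  by apply: stable_row klX; rewrite -?val_eqE /=; lia.
have [/val_inj<- //|lj'] := eqVneq (l : nat) j.
by apply: stable_col ilX; rewrite -?val_eqE /=; lia.
Qed.

Lemma diag_step_or_scalar z : (forall i j, i != j -> z i j = 0) ->
  (exists k l, l = k.+1 :> nat /\ z k k != z l l) \/ exists c, z = c%:M.
Proof.
move=> zd.
case: (boolP [exists p : 'I_n * 'I_n, (p.2 == p.1.+1 :> nat) && (z p.1 p.1 != z p.2 p.2)]).
  by case/existsP => -[k l] /andP[/eqP]; left; exists k, l.
move/existsPn => /= const; right.
have step k l : l = k.+1 :> nat -> z k k = z l l.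
  by move=> lk; have := const (k, l); rewrite /= lk eqxx /= negbK => /eqP.
have eq_m m : forall k l, l = (k + m)%N :> nat -> z k k = z l l.
  elim: m => [|m IHm] k l lk; first by congr (z _ _); apply: val_inj; rewrite /= lk addn0.
  have kn : (k.+1 < n)%N by have := ltn_ord l; lia.
  by rewrite (step k (Ordinal kn)) //; apply: IHm => /=; lia.
have eq_all k l : z k k = z l l.
  wlog kl : k l / (k <= l)%N => [th|].
    by case: (leqP k l) => [|/ltnW] /th.
  by apply: (eq_m (l - k)%N); rewrite subnKC.
case: (pickP 'I_n) => [i0 _|none]; last first.
  by exists 0; apply/matrixP => i; have := none i.
exists (z i0 i0); apply/matrixP => i j; rewrite mxE.
by have [<-|ij] := eqVneq i j; [rewrite mulr1n; apply: eq_all | rewrite mulr0n zd].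
Qed.

(* The positive roots above the simple roots [p] and [n - p] number
   [2 * p * q - minn p q ^ 2] with [q = n - p]. *)
Lemma diag_pair_dim z z' k l k' l' : (forall i j, i != j -> z i j = 0) ->
    (forall i j, i != j -> z' i j = 0) -> z \in X -> z' \in X ->
    l = k.+1 :> nat -> z k k != z l l -> l' = k'.+1 :> nat -> z' k' k' != z' l' l' ->
    (l + l')%N = n -> n <> 4 -> (n + n <= \dim X + 2)%N.
Proof.
move=> zd zd' zX zX' lk zkl lk' zkl' ll n4.
have klX : delta_mx k l \in X by apply: stable_diag zkl => //; rewrite lk.
have klX' : delta_mx k' l' \in X by apply: stable_diag zkl' => //; rewrite lk'.
have RX p : p \in rectangle n l l :|: rectangle n l' l' ->
    (p.1 < p.2)%N && (delta_mx p.1 p.2 \in X).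
  case: p => i j; rewrite !inE /= => /orP[] /andP[il lj]; apply/andP; split.
  - exact: leq_trans lj.
  - by apply: (stable_rectangle klX) => //; rewrite -ltnS -lk.
  - exact: leq_trans lj.
  - by apply: (stable_rectangle klX') => //; rewrite -ltnS -lk'.
(* The diagonal matrix [z] supplies the one dimension beyond the root vectors that makes the final
   count sharp enough. *)
have [m mz] : exists m, z m m != 0.
  have [zk|] := eqVneq (z k k) 0; last by exists k.
  by exists l; rewrite eq_sym -zk.
have : (#|rectangle n l l :|: rectangle n l' l'| < \dim X)%N.
  apply: (card_units_lt_dim _ _ zX mz) => p /RX /andP[] //.
  by move=> lt_p _; rewrite -val_eqE /= ltn_eqF.
(* As [l + l' = n], the overlap is a square of side [minn l l']. *)
have RI : rectangle n l l :&: rectangle n l' l' = rectangle n (minn l l') (maxn l l').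
  apply/setP => -[i j]; rewrite !inE /= leq_min geq_max.
  by case: (i < l)%N; case: (i < l')%N; rewrite ?andbT ?andbF.
have le_n := (ltnW (ltn_ord l), ltnW (ltn_ord l')).
rewrite cardsU RI !card_rectangle ?geq_min ?geq_max ?le_n //.
have l0 : (0 < l)%N by rewrite lk.
have l0' : (0 < l')%N by rewrite lk'.
have := two_rectangles_bound l0 l0'; rewrite ll => /(_ n4).
have nl : (n - l = l')%N by rewrite -{1}ll addKn.
have nl' : (n - l' = l)%N by rewrite -{1}ll addnK.
have max_min : (n - maxn l l' = minn l l')%N by rewrite -{1}ll -addn_min_max addnK.
rewrite nl nl' max_min [(l' * l)%N]mulnC.
have : (minn l l' * minn l l' <= l * l')%N by rewrite leq_mul ?geq_minl ?geq_minr.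
move: (\dim X : nat) (l * l')%N (minn l l' * minn l l')%N.
clear => d a b; lia.
Qed.

End BorelStable.

(** * Separability of traceless subspaces of small dimension *)

Section SmallSubspaces.
Variables (F : numFieldType) (n : nat).
Implicit Types (A B z : 'M[F]_n) (i j k l : 'I_n) (W X : {vspace 'M[F]_n}).

Definition rev_perm : 'S_n := perm (@rev_ord_inj n).

Lemma rev_conjE A i j :
  (perm_mx rev_perm *m A *m perm_mx rev_perm^-1%g) i j = A (rev_ord i) (rev_ord j).
Proof. by rewrite -row_permE -col_permE !mxE !permE. Qed.

Lemma borel_separable X : n <> 4 -> (\dim X + 2 < n + n)%N ->
  graded (mx_grading F n) X -> ad_stable X -> traceless X -> separable X.
Proof.
move=> n4 dimX gX adX trX; exists (perm_mx rev_perm), (perm_mx rev_perm^-1%g).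
split=> [|z zX]; first by rewrite -perm_mxM mulgV perm_mx1.
set z' := _ *m _ => zX'.
have no_lower i j : (j < i)%N -> delta_mx i j \notin X.
  by move=> ji; apply/negP => /(lower_unit_dim adX ji); rewrite leqNgt dimX.
(* A nonzero entry at [(i, j)] puts both [E_ij] and its reversal in [X], and one of the two is
   strictly lower triangular. *)
have zd i j : i != j -> z i j = 0.
  move=> ij; apply/eqP/negPn/negP => zij.
  have r_ij : rev_ord i != rev_ord j by rewrite (inj_eq rev_ord_inj).
  have := graded_delta gX r_ij zX'; rewrite rev_conjE !rev_ordK => /(_ zij).
  have := graded_delta gX ij zX zij.
  case: (ltngtP i j) => [lt_ij|lt_ji|/val_inj E]; last by rewrite E eqxx in ij.
    by move=> _; apply/negP/no_lower; rewrite /=; have := ltn_ord j; lia.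
  by move=> + _; apply/negP/no_lower.
have zd' i j : i != j -> z' i j = 0.
  by move=> ij; rewrite rev_conjE zd // (inj_eq rev_ord_inj).
case: (diag_step_or_scalar zd) => [[k [l [lk zkl]]]|[c zc]].
  have : (n + n <= \dim X + 2)%N.
    (* Reversal turns the jump of [z] between [k] and [l] into a jump of [z'] between [rev_ord l]
       and [rev_ord k], and [l + rev_ord k = n]. *)
    apply: (diag_pair_dim adX zd zd' zX zX' lk zkl (k' := rev_ord l) (l' := rev_ord k)) => //.
    - by rewrite /= lk; have := ltn_ord l; lia.
    - by rewrite !rev_conjE !rev_ordK eq_sym.
    - by rewrite /= lk; have := ltn_ord l; lia.
  by rewrite leqNgt dimX.
rewrite zc; have := trX _ zX; rewrite zc mxtrace_scalar => /eqP.
rewrite mulrn_eq0 => /orP[/eqP n0|/eqP->]; last by rewrite raddf0.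
by exfalso; move: (leq_ltn_trans (leq0n _) dimX); rewrite n0.
Qed.

Lemma small_separable W : n <> 4 -> (\dim W + 2 < n + n)%N -> traceless W ->
  separable W.
Proof.
move=> n4 dimW W0; apply: (separable_by_descent _ W0 erefl) => X gX adX trX XW.
by apply: borel_separable; rewrite ?XW.
Qed.

End SmallSubspaces.

(** * Orthogonal complements for the trace form *)

Section TraceDuality.
Variables (F : fieldType) (n : nat).
Implicit Types (A B C : 'M[F]_n) (Y : {vspace 'M[F]_n}).

Definition trace_pairing Y C : 'rV[F]_(\dim Y) :=
  \row_i \tr (C *m (vbasis Y)`_i).

Fact trace_pairing_is_linear Y : linear (trace_pairing Y).
Proof.
by move=> c A B; apply/rowP => i; rewrite !mxE mulmxDl -scalemxAl linearP.
Qed.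
HB.instance Definition _ Y :=
  GRing.isLinear.Build F _ _ *:%R _ (trace_pairing_is_linear Y).

Definition trace_perp Y : {vspace 'M[F]_n} := lker (linfun (trace_pairing Y)).

Lemma trace_perpP Y C :
  reflect (forall B, B \in Y -> \tr (C *m B) = 0) (C \in trace_perp Y).
Proof.
rewrite memv_ker lfunE /=; apply: (iffP eqP) => [CY B BY | CY].
  rewrite (coord_vbasis BY) mulmx_sumr linear_sum big1 // => i _ /=.
  by rewrite -scalemxAr linearZ /=; move/rowP/(_ i): CY; rewrite !mxE => ->; rewrite mulr0.
by apply/rowP => i; rewrite !mxE CY // vbasis_mem // mem_nth // size_tuple.
Qed.

(** Rank-nullity for the pairing, which is onto because the trace form is nondegenerate. *)
Lemma dim_trace_perp Y : (\dim (trace_perp Y) + \dim Y)%N = (n * n)%N.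
Proof.
have -> : (n * n)%N = \dim (fullv : {vspace 'M[F]_n}) by rewrite dimvf dim_matrix.
rewrite -(limg_ker_dim (linfun (trace_pairing Y)) fullv) capfv; congr (_ + _)%N.
suff -> : limg (linfun (trace_pairing Y)) = fullv.
  by rewrite dimvf dim_matrix; apply: esym (mul1n _).
apply/eqP; rewrite eqEsubv subvf; apply/subvP => v _; apply/memv_imgP.
(* Each matrix in this sum represents a coordinate functional of [vbasis Y] under the trace form,
   whence the transposed [delta_mx l k]. *)
exists (\sum_i v 0 i *: \matrix_(k, l) coord (vbasis Y) i (delta_mx l k)).
  exact: memvf.
rewrite lfunE; apply/rowP => j; rewrite mxE mulmx_suml linear_sum (bigD1 j) //=.
have trE i : \tr ((\matrix_(k, l) coord (vbasis Y) i (delta_mx l k)) *m (vbasis Y)`_j)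
    = (i == j)%:R.
  rewrite eq_sym -(coord_free j i (basis_free (vbasisP Y))) [in RHS](matrix_sum_delta (vbasis Y)`_j).
  rewrite exchange_big linear_sum; apply: eq_bigr => k _; rewrite mxE linear_sum.
  by apply: eq_bigr => l _; rewrite mxE linearZ /= mulrC.
rewrite -scalemxAl linearZ /= trE eqxx mulr1 big1 ?addr0 // => i /negPf ij.
by rewrite -scalemxAl linearZ /= trE ij mulr0.
Qed.

End TraceDuality.

(** * Translates of a subspace of traceless matrices *)

Section SpecialLinearDiameter.
Variables (F : numClosedFieldType) (n : nat).
Hypothesis n_gt0 : (0 < n)%N.
Implicit Types (U : {vspace sl F n}) (A B C : 'M[F]_n).

Definition sl_val : 'Hom(sl F n, 'M[F]_n) := linfun (@vsval _ _ (sl_vspace F n)).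

Lemma sl_valE (x : sl F n) : sl_val x = vsval x.
Proof. by rewrite lfunE. Qed.

Lemma dim_sl_val U : \dim (sl_val @: U) = \dim U.
Proof.
apply: limg_dim_eq; apply/eqP; rewrite -subv0; apply/subvP => x /memv_capP[_].
by rewrite memv_ker sl_valE memv0 -(inj_eq (@subvs_inj _ _ _)) linear0.
Qed.

Lemma mxtrace_sl_val U B : B \in (sl_val @: U)%VS -> \tr B = 0.
Proof.
by case/memv_imgP => x _ ->; apply/eqP; rewrite sl_valE -mem_sl_vspace subvsP.
Qed.

Lemma dim_scalar_line : \dim <[1%:M : 'M[F]_n]> = 1%N.
Proof.
rewrite dim_vline; case: eqP => // /matrixP /(_ (Ordinal n_gt0) (Ordinal n_gt0)).
by rewrite !mxE eqxx => /eqP; rewrite oner_eq0.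
Qed.

Lemma dim_sl : (\dim {: sl F n}).+1 = (n * n)%N.
Proof.
rewrite -(dim_trace_perp <[1%:M : 'M[F]_n]>) dim_scalar_line addn1 dimvf.
congr (\dim _).+1; apply/vspaceP => A; rewrite mem_sl_vspace.
apply/eqP/trace_perpP => [A0 B /vlineP[c ->]|A0].
  by rewrite -scalemxAr mulmx1 linearZ /= A0 mulr0.
by rewrite -[A]mulmx1 A0 // memv_line.
Qed.

(** Adding the scalars makes the orthogonal complement traceless, so it is the complement of [U]
    within traceless matrices. *)
Definition with_scalars U : {vspace 'M[F]_n} := (<[1%:M]> + sl_val @: U)%VS.

Lemma dim_with_scalars U : \dim (with_scalars U) = (\dim U).+1.
Proof.
rewrite dimv_disjoint_sum ?dim_scalar_line ?dim_sl_val ?add1n //.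
apply/eqP; rewrite -subv0; apply/subvP => A /memv_capP[/vlineP[c ->] /mxtrace_sl_val].
rewrite linearZ /= mxtrace1 => /eqP.
rewrite mulf_eq0 pnatr_eq0 eqn0Ngt n_gt0 orbF => /eqP ->.
by rewrite scale0r mem0v.
Qed.

Lemma trace_perp_traceless U : traceless (trace_perp (with_scalars U)).
Proof.
move=> A /trace_perpP A0; rewrite -[A]mulmx1 A0 //.
by rewrite (subvP (addvSl _ _)) ?memv_line.
Qed.

(** Dividing [h] by an [n]-th root of its determinant leaves the conjugation unchanged. *)
Lemma separable_SL (W : {vspace 'M[F]_n}) : separable W ->
  exists g : SL F n, forall A, A \in W -> val g *m A *m invmx (val g) \in W -> A = 0.
Proof.
case=> h [k [hk sep]].
pose c := n.-root (\det h).
have cE : c ^+ n = \det h by rewrite rootCK.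
have det_h : \det h != 0.
  by rewrite -unitfE -unitmxE; case: (mulmx1_unit hk).
have c0 : c != 0 by apply: contra_neq det_h; rewrite -cE => ->; rewrite expr0n gtn_eqF.
have det1 : \det (c^-1 *: h) == 1 by rewrite detZ exprVn cE mulVf.
exists (exist _ (c^-1 *: h) det1) => A AW /=.
have -> : invmx (c^-1 *: h) = c *: k.
  have E : (c^-1 *: h) *m (c *: k) = 1%:M.
    by rewrite -scalemxAl -scalemxAr scalerA mulVf // scale1r.
  have [U _] := mulmx1_unit E.
  by rewrite -[RHS](mulKmx U) E mulmx1.
rewrite -!scalemxAl -scalemxAr scalerA mulVf // scale1r.
exact: sep.
Qed.

Lemma translates_span2 U : n <> 4 -> ((n - 1) ^ 2 < \dim U)%N ->
  translates_span (sl_conj_rep F n) U 2.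
Proof.
move=> n4 dimU; set W := trace_perp (with_scalars U).
have [] := @separable_SL W.
  apply: small_separable => //; last exact: trace_perp_traceless.
  (* Here [\dim W = n ^ 2 - 1 - \dim U], at most [n ^ 2 - (n - 1) ^ 2 - 2 = 2 * n - 3]. *)
  have := dim_trace_perp (with_scalars U); rewrite dim_with_scalars -/W.
  move: dimU n_gt0; move: (\dim U : nat) (\dim W : nat) => a b.
  by case: (n) => // m; rewrite subn1 /= -mulnn; clear; nia.
move=> g sep; exists (fun i => if i == 0 then 1%g else g).
rewrite big_ord_recl big_ord1 /=; set S := (_ + _)%VS.
apply/eqP; rewrite eqEdim subvf /= leqNgt; apply/negP => dimS.
(* If the two translates fail to span, some nonzero traceless [C] is orthogonal to both. *)
have [C CS C0] : exists2 C, C \in trace_perp (with_scalars S) & C != 0.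
  exists (vpick (trace_perp (with_scalars S))); first exact: memv_pick.
  rewrite vpick0 -dimv_eq0; apply/eqP => E.
  have := dim_trace_perp (with_scalars S); rewrite E dim_with_scalars -dim_sl.
  by case=> dE; rewrite dE ltnn in dimS.
have /trace_perpP CP := CS.
have SC (x : sl F n) : x \in S -> \tr (C *m vsval x) = 0.
  by move=> xS; apply: CP; rewrite -sl_valE (subvP (addvSr _ _)) ?memv_img.
have C_tr : \tr C = 0 by apply: trace_perp_traceless CS.
have gu := SL_unitmx g.
have C_W : C \in W.
  apply/trace_perpP => B /memv_addP[_ /vlineP[c ->] [_ /memv_imgP[x xU ->] ->]].
  rewrite mulmxDr -scalemxAr mulmx1 linearD linearZ /= C_tr mulr0 add0r sl_valE SC //.
  apply: (subvP (addvSl _ _)); rewrite -[x]id_lfunE -(rep1 (sl_conj_rep F n)).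
  exact: memv_img.
have C_W' : invmx (val g) *m C *m val g \in W.
  have trC (x : sl F n) : \tr (invmx (val g) *m C *m val g *m vsval x) =
      \tr (C *m vsval (sl_conj_rep F n g x)).
    by rewrite lfunE /= -!mulmxA mxtrace_mulC !mulmxA.
  have trC1 : \tr (invmx (val g) *m C *m val g) = 0.
    by rewrite -mulmxA mxtrace_mulC -mulmxA mulmxV // mulmx1.
  apply/trace_perpP => B /memv_addP[_ /vlineP[c ->] [_ /memv_imgP[x xU ->] ->]].
  rewrite mulmxDr -scalemxAr mulmx1 linearD linearZ /= trC1 mulr0 add0r sl_valE trC.
  by apply: SC; apply: (subvP (addvSr _ _)); apply: memv_img.
(* Separation is applied to [g^-1 C g], whose conjugate by [g] is [C]; both lie in [W]. *)
have := sep _ C_W'; rewrite !mulmxA mulmxV // mul1mx -mulmxA mulmxV // mulmx1.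
move=> /(_ C_W) /(congr1 (fun M => val g *m M *m invmx (val g))).
rewrite !mulmxA mulmxV // mul1mx -mulmxA mulmxV // mulmx1 mulmx0 mul0mx => E.
by rewrite E eqxx in C0.
Qed.

(** Each translate has dimension at most [\dim U], so at most one of them cannot fill the space. *)
Lemma translates_span_gt1 U d : (\dim U < n ^ 2 - 1)%N ->
  translates_span (sl_conj_rep F n) U d -> (1 < d)%N.
Proof.
move=> dimU [g gU]; rewrite ltnNge; apply/negP => d1.
have dimS : (n ^ 2 - 1)%N = \dim {: sl F n} by rewrite -mulnn -dim_sl subn1.
have : (\dim {: sl F n} <= \dim U)%N.
  rewrite -gU; apply: leq_trans (dimv_leq_sum _ _ _) _.
  have le_U i : (\dim (sl_conj_rep F n (g i) @: U) <= \dim U)%N.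
    by rewrite -(limg_ker_dim (sl_conj_rep F n (g i)) U) leq_addl.
  apply: leq_trans (leq_sum _ (fun i _ => le_U i)) _.
  by rewrite sum_nat_const card_ord -[leqRHS]mul1n leq_mul2r d1 orbT.
by rewrite -dimS leqNgt dimU.
Qed.

End SpecialLinearDiameter.

Unset Implicit Arguments.

Theorem theorem1p6 (R : realType) (n d : nat) (U : {vspace sl R[i] n})
    (n_gt0 : (0 < n)%N) (n_neq4 : n <> 4)
    (dimU : \dim U = d)
    (d_gt : ((n - 1) ^ 2 < d)%N) (d_lt : (d < n ^ 2 - 1)%N) :
  additive_diam (sl_conj_rep R[i] n) U = Some 2.
Proof.
have span2 : translates_span (sl_conj_rep R[i] n) U 2.
  by apply: translates_span2; rewrite ?dimU.
rewrite /additive_diam; case: pselect => [exU|[]]; last by exists 2.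
congr Some; case: ex_minnP => m /asboolP span_m min_m; apply/eqP.
rewrite eqn_leq min_m; last exact/asboolP.
by apply: translates_span_gt1 span_m; rewrite ?dimU.
Qed.
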